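(* Let $\mathcal{A}=(a_{ijk})$ be a 3rd order 3-dimensional real symmetric tensor with all entries $a_{ijk}\in\{-1,0,1\}$. Suppose that $r,s,t\in\{1,2,3\}$ are such that $r\neq s$, $s\neq t$, $r\neq t$ and $$a_{rss}=a_{rtt}=1,\qquad a_{123}=-1.$$ Then $\mathcal{A}$ is strictly copositive if and only if both of the following hold: (i) $a_{iii}=1$ and $a_{iij}+a_{ijj}\ge 0$ for all $i,j\in\{1,2,3\}$ with $i\neq j$; (ii) either $a_{rrs}+a_{rrt}\ge 0$, or else [$a_{stt}=a_{sst}=1$ and ($(a_{rrs},a_{rrt})=(0,-1)$ or $(a_{rrs},a_{rrt})=(-1,0)$)].
   Context: A 3rd order 3-dimensional real symmetric tensor is an array $\mathcal{A}=(a_{ijk})_{1\le i,j,k\le 3}$ of real numbers whose entries are invariant under every permutation of the indices. For $x=(x_1,x_2,x_3)^\top\in\mathbb{R}^3$ put $\mathcal{A}x^3=\sum_{i,j,k=1}^3 a_{ijk}x_ix_jx_k$. $\mathcal{A}$ is strictly copositive if $\mathcal{A}x^3>0$ for every $x\neq 0$ with $x_1,x_2,x_3\ge 0$. *)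

(* Defs.v *)
From mathcomp Require Import all_boot all_order all_algebra.
From mathcomp Require Import reals.
Set Implicit Arguments.
Unset Strict Implicit.
Unset Printing Implicit Defensive.

Import Order.TTheory GRing.Theory Num.Theory.

Local Open Scope ring_scope.

(* Indices run over 'I_3 = {0, 1, 2}, so the entry usually written a_{123}
   is A 0 1 2. *)
Definition tensor33 (R : realType) := 'I_3 -> 'I_3 -> 'I_3 -> R.

Definition tensor_symmetric (R : realType) (A : tensor33 R) : Prop :=
  forall i j k : 'I_3,
    [/\ A i k j = A i j k,
        A j i k = A i j k,
        A j k i = A i j k,
        A k i j = A i j k
      & A k j i = A i j k].

Definition cubic_form (R : realType) (A : tensor33 R) (x : 'cV[R]_3) : R :=
  \sum_(i < 3) \sum_(j < 3) \sum_(k < 3) A i j k * x i 0 * x j 0 * x k 0.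

Definition strictly_copositive (R : realType) (A : tensor33 R) : Prop :=
  forall x : 'cV[R]_3,
    x != 0 -> (forall i : 'I_3, 0 <= x i 0) -> 0 < cubic_form A x.

(* Main.v *)
Require Import Defs.
From mathcomp Require Import all_boot all_order all_algebra.
From mathcomp Require Import reals.
From mathcomp Require Import ring lra.

Import Order.TTheory GRing.Theory Num.Theory.

Local Open Scope ring_scope.

(** Writing (x, y, z) = (x_r, x_s, x_t), (p, q) = (a_rrs, a_rrt) and
    (u, v) = (a_sst, a_stt), the form is
    x^3 + y^3 + z^3 + 3 x^2 (p y + q z) + 3 x (y - z)^2 + 3 y z (u y + v z).

    If p + q >= 0 and u + v >= 0, both linear factors are at least -|y - z|, and
    for d = z - y >= 0 the form is at least (x - d)^3 + 2 d^3 + 2 y^3 >= 0.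
    If (p, q, u, v) = (0, -1, 1, 1), completing the square in y after dropping
    y^3 leaves a positive binary quartic in x, z.  Conversely, evaluating at
    (10, 3, 5) and (10, 5, 3) rules out all remaining cases. *)

Definition ternary_form {R : pzRingType} (a b c p q u v x y z : R) : R :=
  a * x ^+ 3 + b * y ^+ 3 + c * z ^+ 3
  + 3 * x ^+ 2 * (p * y + q * z) + 3 * x * (y - z) ^+ 2
  + 3 * y * z * (u * y + v * z).

(** The roles of [s] and [t] are interchangeable; this supplies the reduction to [y <= z] and one of
    the two exceptional cases. *)
Lemma ternary_formC {R : comPzRingType} (a b c p q u v x y z : R) :
  ternary_form a b c p q u v x y z = ternary_form a c b q p v u x z y.
Proof. by rewrite /ternary_form; ring. Qed.

Lemma sum_distinct3 {V : nmodType} (f : 'I_3 -> V) {r s t : 'I_3} :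
  r != s -> s != t -> r != t -> \sum_i f i = f r + f s + f t.
Proof.
move=> rs st rt; rewrite (bigD1 r) //= (bigD1 s) /=; last by rewrite eq_sym.
rewrite (big_pred1 t) ?addrA // => i /=; apply/idP/idP => [|/eqP->]; last first.
  by rewrite eq_sym rt eq_sym st.
by move: r s t i rs st rt => [[|[|[|?]]] ?] [[|[|[|?]]] ?] [[|[|[|?]]] ?]
  [[|[|[|?]]] ?].
Qed.

Lemma symmetric_distinct {R : realType} {A : tensor33 R} {r s t : 'I_3} :
  tensor_symmetric A -> r != s -> s != t -> r != t -> A r s t = A 0 1 2.
Proof.
move=> symA; have [e1 e2 e3 e4 e5] := symA 0 1 2.
have ord3 (i : 'I_3) : [\/ i = 0, i = 1 | i = 2].
  by case: i => [[|[|[|?]]] ?] //; [constructor 1|constructor 2|constructor 3];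
    exact: val_inj.
by case: (ord3 r) (ord3 s) (ord3 t) => -> [] -> [] ->; rewrite ?eqxx.
Qed.

Section Reduction.
Context {R : realType} {A : tensor33 R} {r s t : 'I_3}.
Hypotheses (symA : tensor_symmetric A) (rs : r != s) (st : s != t) (rt : r != t).
Hypotheses (Arss : A r s s = 1) (Artt : A r t t = 1) (A012 : A 0 1 2 = -1).

Local Notation form := (ternary_form (A r r r) (A s s s) (A t t t)
  (A r r s) (A r r t) (A s s t) (A s t t)).

(** The given entries contribute 3 x y^2 + 3 x z^2 - 6 x y z, which is the term 3 x (y - z)^2. *)
Lemma cubic_formE (x : 'cV[R]_3) :
  cubic_form A x = form (x r 0) (x s 0) (x t 0).
Proof.
have Arst : A r s t = -1 by rewrite symmetric_distinct.
rewrite /cubic_form !(sum_distinct3 _ rs st rt).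
have [e1 e2 e3 e4 e5] := symA r s t; rewrite e1 e2 e3 e4 e5.
have [_ f2 f3 _ _] := symA r s s; rewrite f2 f3.
have [_ g2 g3 _ _] := symA r t t; rewrite g2 g3.
have [h1 _ _ h4 _] := symA r r s; rewrite h1 h4.
have [i1 _ _ i4 _] := symA r r t; rewrite i1 i4.
have [j1 _ _ j4 _] := symA s s t; rewrite j1 j4.
have [_ k2 k3 _ _] := symA s t t; rewrite k2 k3.
by rewrite Arst Arss Artt /ternary_form; ring.
Qed.

Lemma strictly_copositiveP :
  strictly_copositive A <->
  forall x y z : R, 0 <= x -> 0 <= y -> 0 <= z -> 0 < x + y + z ->
    0 < form x y z.
Proof.
split=> [copA x y z x0 y0 z0 xyz | posF x xn0 x0].
  pose w : 'cV[R]_3 :=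
    \col_i (if i == r then x else if i == s then y else z).
  have wr : w r 0 = x by rewrite mxE eqxx.
  have ws : w s 0 = y by rewrite mxE eq_sym (negPf rs) eqxx.
  have wt : w t 0 = z by rewrite mxE !(eq_sym t) (negPf rt) (negPf st).
  rewrite -wr -ws -wt -cubic_formE; apply: copA => [|i].
    apply/eqP => w0; move: xyz.
    by rewrite -wr -ws -wt w0 !mxE !addr0 ltxx.
  by rewrite mxE; do 2?case: ifP.
rewrite cubic_formE; apply: posF => //.
rewrite -(sum_distinct3 (fun i => x i 0) rs st rt) lt_neqAle sumr_ge0 // andbT.
apply: contra xn0; rewrite eq_sym psumr_eq0 // => /allP xi0.
apply/eqP/matrixP => i j; rewrite ord1 mxE.
by apply/eqP; apply: xi0; rewrite mem_index_enum.
Qed.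

End Reduction.

Section Positivity.
Context {R : realFieldType}.
Implicit Types p q u v x y z : R.

Lemma ternary_form_gt0_le p q u v x y z :
  p <= 1 -> v >= -1 -> u <= 1 -> 0 <= p + q -> 0 <= u + v ->
  0 <= x -> 0 <= y -> y <= z -> 0 < x + y + z ->
  0 < ternary_form 1 1 1 p q u v x y z.
Proof.
move=> p1 v1 u1 pq uv x0 y0 yz xyz.
have d0 : 0 <= z - y by lra.
have Lpq : 0 <= p * y + q * z + (z - y).
  have -> : p * y + q * z + (z - y) = (p + q) * z + (1 - p) * (z - y) by ring.
  by rewrite addr_ge0 ?mulr_ge0 //; lra.
have Luv : 0 <= u * y + v * z + (z - y).
  have -> : u * y + v * z + (z - y) = (u + v) * z + (1 - u) * (z - y) by ring.
  by rewrite addr_ge0 ?mulr_ge0 //; lra.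
(* With d = z - y, this rests on y^3 + z^3 - 3 y z d = d^3 + 2 y^3. *)
have -> : ternary_form 1 1 1 p q u v x y z =
    3 * x ^+ 2 * (p * y + q * z + (z - y))
    + 3 * y * z * (u * y + v * z + (z - y))
    + ((x - (z - y)) ^+ 3 + 2 * (z - y) ^+ 3 + 2 * y ^+ 3).
  by rewrite /ternary_form; ring.
apply: ltr_wpDl.
  by rewrite addr_ge0 // mulr_ge0 // !mulr_ge0 //; lra.
set d := z - y in d0 *.
have -> : (x - d) ^+ 3 + 2 * d ^+ 3 + 2 * y ^+ 3 =
    d ^+ 3 + 2 * y ^+ 3 + x * ((x - 3 / 2 * d) ^+ 2 + 3 / 4 * d ^+ 2) by field.
have Q0 : 0 <= x * ((x - 3 / 2 * d) ^+ 2 + 3 / 4 * d ^+ 2).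
  by rewrite mulr_ge0 // addr_ge0 ?sqr_ge0 // mulr_ge0 ?sqr_ge0 //; lra.
have d3 : 0 <= d ^+ 3 by rewrite exprn_ge0.
have y3 : 0 <= y ^+ 3 by rewrite exprn_ge0.
(* Strictness: if d and y both vanish, so does z, and only x^3 > 0 is left. *)
have [dp|dn] := ltP 0 d; first by have : 0 < d ^+ 3 by [rewrite exprn_gt0|]; lra.
have [yp|yn] := ltP 0 y; first by have : 0 < y ^+ 3 by [rewrite exprn_gt0|]; lra.
have dE : d = 0 by lra.
have yE : y = 0 by lra.
have xp : 0 < x by move: dE; rewrite /d; lra.
have -> : d ^+ 3 + 2 * y ^+ 3 + x * ((x - 3 / 2 * d) ^+ 2 + 3 / 4 * d ^+ 2) =
  x ^+ 3 by rewrite dE yE; ring.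
by rewrite exprn_gt0.
Qed.

Lemma ternary_form_gt0 p q u v x y z :
  p <= 1 -> q <= 1 -> u <= 1 -> v <= 1 -> 0 <= p + q -> 0 <= u + v ->
  0 <= x -> 0 <= y -> 0 <= z -> 0 < x + y + z ->
  0 < ternary_form 1 1 1 p q u v x y z.
Proof.
move=> p1 q1 u1 v1 pq uv x0 y0 z0 xyz; have [yz|/ltW zy] := leP y z.
  by apply: ternary_form_gt0_le => //; lra.
by rewrite ternary_formC; apply: ternary_form_gt0_le => //; lra.
Qed.

Lemma ternary_form_exceptional_gt0 x y z :
  0 <= x -> 0 <= y -> 0 <= z -> 0 < x + y + z ->
  0 < ternary_form 1 1 1 0 (-1) 1 1 x y z.
Proof.
move=> x0 y0 z0 xyz.
(* Apart from y^3, the form is quadratic in y with leading coefficient 3 (x + z), so x = z = 0 is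
   treated separately. *)
have [xz|xz] := ltP 0 (x + z); last first.
  have -> : x = 0 by lra.
  have -> : z = 0 by lra.
  have -> : ternary_form 1 1 1 0 (-1) 1 1 0 y 0 = y ^+ 3.
    by rewrite /ternary_form; ring.
  by rewrite exprn_gt0 //; lra.
(* The cubic factor of x in the quartic is minimal near x = 1.9 z. *)
pose Q := x * (4 * ((x - 19 / 10 * z) ^+ 2 * (x + 9 / 5 * z))
               + 23 / 25 * (x * z ^+ 2) + 251 / 125 * z ^+ 3) + z ^+ 4.
have Q0 : 0 < Q.
  have [zp|zn] := ltP 0 z.
    apply: ltr_wpDl; last by rewrite exprn_gt0.
    have c1 : 0 <= (x - 19 / 10 * z) ^+ 2 * (x + 9 / 5 * z).
      by rewrite mulr_ge0 ?sqr_ge0 //; lra.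
    have c2 : 0 <= x * z ^+ 2 by rewrite mulr_ge0 ?sqr_ge0.
    have c3 : 0 <= z ^+ 3 by rewrite exprn_ge0.
    by rewrite mulr_ge0 //; lra.
  have zE : z = 0 by lra.
  have -> : Q = 4 * x ^+ 4 by rewrite /Q zE; field.
  by rewrite mulr_gt0 // exprn_gt0 //; lra.
(* Completing the square in y: 3 [Q] is minus the discriminant of that quadratic, with [Q] = 4 x^4 -
   8 x^3 z - 12 x^2 z^2 + 28 x z^3 + z^4. *)
have E : 12 * (x + z) * ternary_form 1 1 1 0 (-1) 1 1 x y z =
    12 * (x + z) * y ^+ 3 + (6 * (x + z) * y - 3 * (2 * x - z) * z) ^+ 2 + 3 * Q.
  by rewrite /ternary_form /Q; field.
have c0 : 0 < 12 * (x + z) by lra.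
rewrite -(pmulr_rgt0 _ c0) E; apply: ltr_wpDl; last by lra.
by rewrite addr_ge0 ?sqr_ge0 // mulr_ge0 ?exprn_ge0 //; lra.
Qed.

(** For (p, q) = (0, -1) the first value is positive only if 135 u + 225 v > 228, which forces u = v
    = 1 since 225 < 228. The second value does the same for (-1, 0), and (-1, -1) makes both
    negative. *)
Lemma ternary_form_classification p q u v :
  [\/ p = -1, p = 0 | p = 1] -> [\/ q = -1, q = 0 | q = 1] ->
  [\/ u = -1, u = 0 | u = 1] -> [\/ v = -1, v = 0 | v = 1] ->
  0 < ternary_form 1 1 1 p q u v 10 3 5 ->
  0 < ternary_form 1 1 1 p q u v 10 5 3 ->
  0 <= p + q \/
  [/\ v = 1, u = 1 & (p = 0 /\ q = -1) \/ (p = -1 /\ q = 0)].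
Proof.
move=> pE qE uE vE.
have -> : ternary_form 1 1 1 p q u v 10 3 5 =
    1272 + 900 * p + 1500 * q + 135 * u + 225 * v.
  by rewrite /ternary_form; ring.
have -> : ternary_form 1 1 1 p q u v 10 5 3 =
    1272 + 1500 * p + 900 * q + 225 * u + 135 * v.
  by rewrite /ternary_form; ring.
case: pE qE => -> [] -> F1 F2; try (by left; lra);
  case: uE F1 F2 => ->; case: vE => -> F1 F2;
  first [by exfalso; lra | by right; split; auto].
Qed.

End Positivity.

Theorem theorem3p1 (R : realType) (A : tensor33 R) (r s t : 'I_3)
    (hsym : tensor_symmetric A)
    (hentries : forall i j k : 'I_3, A i j k \in [:: -1; 0; 1])
    (hrs : r != s) (hst : s != t) (hrt : r != t)
    (hrss : A r s s = 1) (hrtt : A r t t = 1)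
    (h123 : A 0 1 2 = -1) :
  strictly_copositive A <->
    ((forall i : 'I_3, A i i i = 1) /\
     (forall i j : 'I_3, i != j -> 0 <= A i i j + A i j j)) /\
    (0 <= A r r s + A r r t \/
     [/\ A s t t = 1, A s s t = 1 &
         (A r r s = 0 /\ A r r t = -1) \/ (A r r s = -1 /\ A r r t = 0)]).
Proof.
have entry i j k : [\/ A i j k = -1, A i j k = 0 | A i j k = 1].
  by have := hentries i j k; rewrite !inE => /or3P[] /eqP->;
    [constructor 1 | constructor 2 | constructor 3].
have entry_le1 i j k : A i j k <= 1 by case: (entry i j k) => ->; lra.
have ord3 (P : 'I_3 -> Prop) : P r -> P s -> P t -> forall i, P i.
  (* The indicator of [i] has total 1, so it cannot vanish at all of [r], [s], [t]. *)
  move=> Pr Ps Pt i; have := sum_distinct3 (fun j => (j == i) : nat) hrs hst hrt.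
  have -> : (\sum_j (j == i) = 1)%N.
    by rewrite (bigD1 i) //= eqxx big1 // => j /negPf ->.
  by have [<-//|_] := eqVneq r i; have [<-//|_] := eqVneq s i;
    have [<-|_] := eqVneq t i.
split=> [/(strictly_copositiveP hsym hrs hst hrt hrss hrtt h123) pos | ].
  have {}pos (x y z : nat) : (0 < x + y + z)%N ->
      0 < ternary_form (A r r r) (A s s s) (A t t t) (A r r s) (A r r t)
            (A s s t) (A s t t) x%:R y%:R z%:R.
    by move=> xyz; apply: pos; rewrite ?ler0n // -!natrD ltr0n.
  (* Unit vectors pin the diagonal to 1. At (0, 1, 1) the form is then 2 + 3 (u + v), so the integer
     u + v is nonnegative. *)
  have F100 := pos 1%N 0%N 0%N isT; have F010 := pos 0%N 1%N 0%N isT.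
  have F001 := pos 0%N 0%N 1%N isT; have F011 := pos 0%N 1%N 1%N isT.
  have F1 := pos 10%N 3%N 5%N isT; have F2 := pos 10%N 5%N 3%N isT.
  rewrite /ternary_form in F100 F010 F001 F011.
  have Ar : A r r r = 1 by case: (entry r r r) => e //; move: F100; rewrite e; lra.
  have As : A s s s = 1 by case: (entry s s s) => e //; move: F010; rewrite e; lra.
  have At : A t t t = 1 by case: (entry t t t) => e //; move: F001; rewrite e; lra.
  rewrite Ar As At in F011 F1 F2.
  have Ast : 0 <= A s s t + A s t t.
    by case: (entry s s t) (entry s t t) => e [] e';
      rewrite e e' in F011 *; lra.
  (* For pairs containing [r] one summand is 1 and the other at least -1. *)
  have Ars : 0 <= A r r s + A r s s by case: (entry r r s) => ->; lra.
  have Art : 0 <= A r r t + A r t t by case: (entry r r t) => ->; lra.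
  have sumC i j : A j j i + A j i i = A i i j + A i j j.
    by have [_ _ ? _ _] := hsym i j j; have [_ _ _ ? _] := hsym i i j; lra.
  split; first split.
  - exact: ord3.
  - by apply: (ord3 _); apply: (ord3 _); rewrite ?eqxx // => _; rewrite sumC.
  - exact: ternary_form_classification.
case=> -[diag edge] H; apply/(strictly_copositiveP hsym hrs hst hrt hrss hrtt h123).
move=> x y z x0 y0 z0 xyz; rewrite !diag.
case: H => [pq | [-> -> [[-> ->]|[-> ->]]]].
- by apply: ternary_form_gt0 => //; exact: edge.
- exact: ternary_form_exceptional_gt0.
- by rewrite ternary_formC; apply: ternary_form_exceptional_gt0 => //; lra.
Qed.
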